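(* Let $q=p^n$ with $p$ prime, let $f\in \mathbb{F}_q[x]$, and let $m,b\in\mathbb{F}_q$. Suppose the line $\{(x,y)\in\mathbb{F}_q^2 : y=mx+b\}$ meets the graph $\{(x,f(x)) : x\in\mathbb{F}_q\}$ of $f$ in exactly $k$ points, where $1<k<q$. Then \[|(D_f-m)^{-1}(D_f-m)|\geq q-k+2.\]
   Context: For $f\in\mathbb{F}_q[x]$ (viewed as a function $\mathbb{F}_q\to\mathbb{F}_q$), the set of directions determined by $f$ is $D_f=\{(f(x)-f(y))/(x-y) : x,y\in\mathbb{F}_q,\ x\neq y\}$. For $A,B\subseteq\mathbb{F}_q$ and $c\in\mathbb{F}_q$: $A-c=\{a-c : a\in A\}$; $A^{-1}=\{a^{-1} : a\in A\setminus\{0\}\}$; $AB=\{ab : a\in A,\ b\in B\}$. *)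

(* Defs.v *)
From mathcomp Require Import all_boot all_order all_algebra all_field.
Set Implicit Arguments.
Unset Strict Implicit.
Unset Printing Implicit Defensive.
Import GRing.Theory.
Local Open Scope ring_scope.

Section Directions.
Variable F : finFieldType.
Implicit Types (f : {poly F}) (A B : {set F}) (c m b : F).

Definition directions f : {set F} :=
  [set (f.[xy.1] - f.[xy.2]) / (xy.1 - xy.2) | xy in [set xy : F * F | xy.1 != xy.2]].

Definition shift_set A c : {set F} := [set a - c | a in A].

Definition inv_set A : {set F} := [set a^-1 | a in A :\ 0].

Definition mul_set A B : {set F} := [set a * b | a in A, b in B].

Definition line m b : {set F * F} := [set P : F * F | P.2 == m * P.1 + b].

Definition graph f : {set F * F} := [set (x, f.[x]) | x : F].

End Directions.

(* Main.v *)
Require Import Defs.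
From mathcomp Require Import all_boot all_order all_algebra all_field.
From mathcomp Require Import ring.
Set Implicit Arguments.
Unset Strict Implicit.
Unset Printing Implicit Defensive.
Import GRing.Theory.
Local Open Scope ring_scope.

(** Put g(x) = f(x) - m x - b, whose zeros are the abscissas of the k common
    points, and fix two distinct zeros z, w.  For every x with g(x) != 0, both
    g(x) / (x - z) and g(x) / (x - w) are nonzero elements of D_f - m, so their
    quotient (x - w) / (x - z) belongs to the set to be bounded.  These q - k
    quotients are pairwise distinct and avoid 0 and 1, which belong to it too. *)

Section Quotients.
Variable F : finFieldType.
Implicit Types (f : {poly F}) (m b x z w : F).

Definition meet_abscissas f m b : {set F} := [set x | f.[x] == m * x + b].

(** A point of the graph is determined by its abscissa, so common points can be counted in [F]. *)
Lemma card_meet_abscissas f m b :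
  #|line m b :&: graph f| = #|meet_abscissas f m b|.
Proof.
have inj_pt : injective (fun x => (x, f.[x])) by move=> x y [].
rewrite -(card_imset _ inj_pt); apply: eq_card => -[x y]; rewrite !inE /=.
apply/andP/imsetP => [[/eqP def_y /imsetP[x' _ [eq_x eq_y]]]|[x' x'P [-> ->]]].
  exists x; last by rewrite eq_y eq_x.
  by rewrite inE -def_y eq_y eq_x.
by rewrite inE in x'P; split=> //; apply: imset_f.
Qed.

(** As [z] lies over a common point, the numerator is (f(x) - f(z)) - m (x - z), so the quotient is
    the slope of the chord from [z] to [x], minus [m]. *)
Lemma mem_shift_directions f m b x z :
  z \in meet_abscissas f m b -> x != z ->
  (f.[x] - (m * x + b)) / (x - z) \in shift_set (directions f) m.
Proof.
rewrite inE => /eqP fz neq_xz; apply/imsetP.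
exists ((f.[x] - f.[z]) / (x - z)).
  by apply/imsetP; exists (x, z); rewrite ?inE.
have nz_xz : x - z != 0 by rewrite subr_eq0.
by rewrite fz; field.
Qed.

Lemma mem_mul_inv_set (A : {set F}) a c :
  a \in A -> a != 0 -> c \in A -> a^-1 * c \in mul_set (inv_set A) A.
Proof.
move=> Aa nz_a Ac; apply: imset2_f => //.
by apply: imset_f; rewrite !inE nz_a.
Qed.

(** This is a Möbius map with pole [z] and determinant w - z up to sign, hence injective where it is
    defined. *)
Lemma quotient_sub_inj z w :
  z != w -> {in [pred x | x != z] &, injective (fun x => (x - w) / (x - z))}.
Proof.
move=> neq_zw x y; rewrite !inE => neq_xz neq_yz /= eq_xy.
have nz_x : x - z != 0 by rewrite subr_eq0.
have nz_y : y - z != 0 by rewrite subr_eq0.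
move/eqP: eq_xy; rewrite eqr_div // -subr_eq0.
have -> : (x - w) * (y - z) - (y - w) * (x - z) = (w - z) * (x - y) by ring.
by rewrite mulf_eq0 !subr_eq0 eq_sym (negPf neq_zw) /= => /eqP.
Qed.

End Quotients.

Theorem theorem1 (p n q : nat) (F : finFieldType)
  (p_prime : prime p) (q_def : q = (p ^ n)%N) (cardF : #|F| = q)
  (f : {poly F}) (m b : F) (k : nat)
  (meet_k : #|line m b :&: graph f| = k) (k_bounds : (1 < k < q)%N) :
  (q - k + 2 <=
     #|mul_set (inv_set (shift_set (directions f) m))
               (shift_set (directions f) m)|)%N.
Proof.
set A := shift_set _ _.
rewrite card_meet_abscissas in meet_k; set Z := meet_abscissas f m b in meet_k.
have /andP[k_gt1 k_ltq] := k_bounds.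
have /card_gt1P[z [w [Zz Zw neq_zw]]] : (1 < #|Z|)%N by rewrite meet_k.
have cardCZ : #|~: Z| = (q - k)%N by rewrite cardsCs setCK cardF meet_k.
have neqZ x y : x \in ~: Z -> y \in Z -> x != y.
  by rewrite inE => nZx Zy; apply: contraNneq nZx => ->.
have Aquo x y : y \in Z -> x \in ~: Z -> (f.[x] - (m * x + b)) / (x - y) \in A.
  by move=> Zy nZx; apply: mem_shift_directions (neqZ _ _ nZx Zy).
have nz_quo x y : y \in Z -> x \in ~: Z -> (f.[x] - (m * x + b)) / (x - y) != 0.
  move=> Zy nZx; rewrite mulf_neq0 ?invr_eq0 ?subr_eq0 ?(neqZ x y) //.
  by move: nZx; rewrite !inE.
(* Here k < q enters: the quotient a at [x0] is a nonzero element of [A], which will give both 0 =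
   a^-1 * 0 and 1 = a^-1 * a. *)
have [x0 nZx0] : exists x0, x0 \in ~: Z.
  by apply/card_gt0P; rewrite cardCZ subn_gt0.
(* The chord joining the two common points over [z] and [w] lies on the line, so its slope is
   [m]. *)
have A0 : 0 \in A.
  have neq_wz : w != z by rewrite eq_sym.
  have := mem_shift_directions Zz neq_wz; move: Zw; rewrite inE => /eqP ->.
  by rewrite subrr mul0r.
pose T : {set F} := [set (x - w) / (x - z) | x in ~: Z].
have cardT : #|T| = (q - k)%N.
  rewrite card_in_imset // => x y nZx nZy; apply: quotient_sub_inj => //; exact: neqZ.
(* A zero quotient forces x = w, or x = z under the convention that 0 is its own inverse; neither
   lies outside [Z]. *)
have T0 : 0 \notin T.
  apply/imsetP => -[x nZx /esym/eqP].
  by rewrite mulf_eq0 invr_eq0 !subr_eq0 !(negPf (neqZ _ _ nZx _)).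
(* A quotient equal to 1 would give x - w = x - z, against the choice of distinct zeros. *)
have T1 : 1 \notin T.
  apply/imsetP => -[x nZx /esym/eqP].
  have nz_xz : x - z != 0 by rewrite subr_eq0 neqZ.
  by rewrite -(divff nz_xz) (inj_eq (mulIf _)) ?invr_eq0 // (inj_eq (addrI x))
             (inj_eq oppr_inj) eq_sym (negPf neq_zw).
have -> : (q - k + 2)%N = #|0 |: (1 |: T)|.
  by rewrite !cardsU1 !inE (negPf T0) T1 eq_sym oner_eq0 cardT addnC.
apply/subset_leq_card/subsetP => t; rewrite !inE => /or3P[/eqP->|/eqP->|].
- rewrite -(mulr0 ((f.[x0] - (m * x0 + b)) / (x0 - z))^-1).
  by apply: mem_mul_inv_set; rewrite ?Aquo ?nz_quo.
- rewrite -(mulVf (nz_quo _ _ Zz nZx0)).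
  by apply: mem_mul_inv_set; rewrite ?Aquo ?nz_quo.
case/imsetP=> x nZx ->.
have -> : (x - w) / (x - z) = ((f.[x] - (m * x + b)) / (x - w))^-1 *
                              ((f.[x] - (m * x + b)) / (x - z)).
  have nz_xz : x - z != 0 by rewrite subr_eq0 neqZ.
  have nz_xw : x - w != 0 by rewrite subr_eq0 neqZ.
  have nz_g : f.[x] - (m * x + b) != 0 by move: nZx; rewrite !inE subr_eq0.
  by field; rewrite nz_xz nz_g nz_xw.
by apply: mem_mul_inv_set; rewrite ?Aquo ?nz_quo.
Qed.
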